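(* Let $a<b$ be real, $d,D\in\mathbb{N}$, and let $F\in L^2([0,1]^{d+D},\mathbb{R})$, $\mathcal{H}$, $\mathcal{L}$, $\mathcal{L}_n$, $f_{\mathcal{H}}$, $f_{n,\mathcal{H}}$ be as in the deep learning problem with uniform input described in the context. Suppose that $F$ satisfies the boundary growth condition with constants $(B_i)_{i=1}^{d+D}$, $B_i>0$. Suppose that $(\boldsymbol{u}_{i})_{i=1}^{\infty}$ are i.i.d. samples from the uniform distribution on $(0,1)^{d+D}$. Then, as $n\to\infty$, $$\mathbb{E}\left[ \mathcal{L}(f_{n,\mathcal{H}})-\mathcal{L}(f_{\mathcal{H}})\right] = O\left(n^{-\frac{1}{2}+\sum_{i=1}^{d+D}B_i}( \log n) ^{\frac{1}{2}}\right).$$ If moreover the constants $(B_i)_{i=1}^{d+D}$ can be chosen arbitrarily small, then for arbitrarily small $\epsilon>0$ (i.e. for every $\epsilon>0$) we have $$\mathbb{E}\left[ \mathcal{L}(f_{n,\mathcal{H}})-\mathcal{L}(f_{\mathcal{H}})\right] = O(n^{-\frac{1}{2}+\epsilon}).$$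
   Context: **Deep learning problem with uniform input.** Let $a\in\mathbb{R}$, $b\in(a,\infty)$, $d,D\in\mathbb{N}$. Let $U_1$ be uniform on $(0,1)^d$ and $U_2$ uniform on $(0,1)^D$, with $U=(U_1,U_2)$ uniform on $(0,1)^{d+D}$. The input and output are $X=a+(b-a)U_1$ (componentwise) and $Y=F(U)$, where $F\in L^2([0,1]^{d+D},\mathbb{R})$. Let $\boldsymbol{u}_i=(\boldsymbol{u}_{i,1},\boldsymbol{u}_{i,2})$, $i\in\mathbb{N}$, be random variables each with the distribution of $U$, and set $\boldsymbol{x}_i=a+(b-a)\boldsymbol{u}_{i,1}$, $\boldsymbol{y}_i=F(\boldsymbol{u}_i)$. Define the risk and empirical risk $$\mathcal{L}(f)=\mathbb{E}[(f(X)-Y)^2],\qquad \mathcal{L}_n(f)=\frac1n\sum_{i=1}^n[f(\boldsymbol{x}_i)-\boldsymbol{y}_i]^2 .$$ For the random function $f_{n,\mathcal{H}}$ below, $\mathcal{L}(f_{n,\mathcal{H}})$ is the functional $\mathcal{L}$ evaluated at the realization of $f_{n,\mathcal{H}}$; the outer expectation is over the data. **Hypothesis class.** Let $L\ge2$, $S=(N_0,\dots,N_L)=(d,N_1,\dots,N_{L-1},1)\in\mathbb{N}^{L+1}$, $R\in(0,\infty)$ and $\rho(x)=\frac{x}{1+\exp(-x)}$ (swish). For $\theta=((A_l,B_l))_{l=1}^L$ with $A_l\in\mathbb{R}^{N_l\times N_{l-1}}$, $B_l\in\mathbb{R}^{N_l}$ (these bias vectors are unrelated to the growth constants $B_i$),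 put $W_l(x)=A_lx+B_l$ and $\Phi_\theta=W_L\circ\rho\circ W_{L-1}\circ\rho\cdots\circ\rho\circ W_1$, with $\rho$ applied componentwise. Let $\Theta_R=\{\theta:\|\theta\|_\infty\le R\}$ and $\mathcal{H}=\{\Phi_\theta|_{[a,b]^d}:\theta\in\Theta_R\}$. The class $\mathcal{H}$ is kept fixed as $n$ varies. Define $f_{\mathcal{H}}=\operatorname{argmin}_{f\in\mathcal{H}}\mathcal{L}(f)$ and $f_{n,\mathcal{H}}=\operatorname{argmin}_{f\in\mathcal{H}}\mathcal{L}_n(f)$. **Boundary growth condition.** For a nonempty $v\subseteq\{1,\dots,s\}$, $D_v g=\left(\prod_{i\in v}\partial/\partial u_i\right)g$, and $D_\emptyset g=g$. A function $g$ on $(0,1)^s$ satisfies the boundary growth condition with constants $(B_i)_{i=1}^s$ if there exists $B\in(0,\infty)$ such that for every $v\subseteq\{1,\dots,s\}$ and $u\in(0,1)^s$, $$|(D_vg)(u)|\le B\prod_{i=1}^s[\min(u_i,1-u_i)]^{-B_i-\mathbf{1}\{i\in v\}}.$$ The constants ''can be chosen arbitrarily small'' means that for every $\delta>0$ there are $B_1,\dots,B_s\in(0,\delta)$ for which the condition holds ($B$ may depend on them). *)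

(* Defs.v *)
From HB Require Import structures.
From mathcomp Require Import all_boot all_order all_algebra.
From mathcomp Require Import finmap.
From mathcomp Require Import all_classical all_reals all_analysis.
From mathcomp Require Import measurable_realfun.
Import Order.TTheory GRing.Theory Num.Theory.
Import numFieldNormedType.Exports.

Set Implicit Arguments.
Unset Strict Implicit.
Unset Printing Implicit Defensive.

Local Open Scope classical_set_scope.
Local Open Scope ring_scope.

(* Points of R^n are n-tuples: the library equips these, unlike matrices, with
   the product sigma-algebra. *)

Definition open_cube (R : realType) (n : nat) : set (n.-tuple R) :=
  [set u | forall i, 0 < tnth u i < 1].

Definition closed_box (R : realType) (a b : R) (n : nat) : set (n.-tuple R) :=
  [set x | forall i, a <= tnth x i <= b].
Arguments closed_box {R} a b n.

(* [measurableTypeR R] is R with the display under which the library states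
   [uniform_prob]; its measurable sets are those of R. *)
Definition cons_pair (R : realType) (n : nat)
  (p : measurableTypeR R * n.-tuple R) : n.+1.-tuple R := [tuple of p.1 :: p.2].

Lemma measurable_cons_pair (R : realType) (n : nat) :
  measurable_fun [set: measurableTypeR R * n.-tuple R] (@cons_pair R n).
Proof.
apply: (@measurable_cons _ _ _ R (fun p => p.1) n (fun p => p.2)).
- exact: (@measurable_fst _ _ (measurableTypeR R) (n.-tuple R)).
- exact: measurable_snd.
Qed.

HB.instance Definition _ (R : realType) (n : nat) :=
  isMeasurableFun.Build _ _ _ _ (@cons_pair R n) (@measurable_cons_pair R n).

(* The library's [uniform_prob] charges the closed interval; the endpoints are
   negligible. *)
Fixpoint uniform_cube (R : realType) (n : nat) : probability (n.-tuple R) R :=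
  if n is m.+1 then
    distribution (@uniform_prob R 0 1 ltr01 \x uniform_cube R m)%E
      (@cons_pair R m)
  else \d_[tuple].

Definition has_law (R : realType) (d d' : measure_display)
    (T : measurableType d) (T' : measurableType d') (P : probability T R)
    (X : {RV P >-> T'}) (Q : probability T' R) : Prop :=
  forall A : set T', measurable A -> distribution P X A = Q A.

Definition mutually_independent (R : realType) (d d' : measure_display)
    (T : measurableType d) (T' : measurableType d') (P : probability T R)
    (X : nat -> {RV P >-> T'}) : Prop :=
  forall (J : {fset nat}) (A : nat -> set T'), (forall i, measurable (A i)) ->
    P (\bigcap_(i in [set` J]) X i @^-1` A i)
      = (\prod_(i <- J) P (X i @^-1` A i))%E.

Section partial_derivatives.
Variables (R : realType) (n : nat).
Implicit Types (g : n.-tuple R -> R) (u : n.-tuple R) (l : seq 'I_n).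

Definition set_coord (i : 'I_n) u (t : R) : n.-tuple R :=
  [tuple if j == i then t else tnth u j | j < n].

Definition partial (i : 'I_n) g : n.-tuple R -> R :=
  fun u => derive1 (fun t : R => g (set_coord i u t)) (tnth u i).

Definition partials l g : n.-tuple R -> R := foldr partial g l.

Fixpoint partials_exist l g : Prop :=
  if l is i :: l' then
    partials_exist l' g /\
    forall u, open_cube u ->
      derivable (fun t : R => partials l' g (set_coord i u t)) (tnth u i) 1
  else True.

(* [enum v] lists v increasingly, so the derivatives in the coordinates of v
   are taken one after the other, the one in the largest coordinate first.
   Since [derive1] is total, their existence is required separately. *)
Definition mixed_partial (v : {set 'I_n}) g := partials (enum v) g.

Definition mixed_partial_exists (v : {set 'I_n}) g :=
  partials_exist (enum v) g.

Definition boundary_growth g (B : 'I_n -> R) : Prop :=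
  exists2 C : R, 0 < C &
  forall v : {set 'I_n}, mixed_partial_exists v g /\
    forall u, open_cube u ->
      `|mixed_partial v g u| <=
      C * \prod_i (Num.min (tnth u i) (1 - tnth u i))
                     `^ (- B i - (i \in v)%:R).

Definition boundary_growth_arbitrarily_small g : Prop :=
  forall delta : R, 0 < delta ->
  exists2 B : 'I_n -> R, (forall i, 0 < B i < delta) & boundary_growth g B.

End partial_derivatives.

Section networks.
Variable R : realType.

Definition swish (x : R) : R := x / (1 + expR (- x)).

(* Parameters ((A_1, B_1), ..., (A_L, B_L)) of a network with layer widths
   (n0, hidden, 1), so that L = (size hidden).+1. *)
Fixpoint params (n0 : nat) (hidden : seq nat) : Type :=
  if hidden is n1 :: hidden' then
    ('M[R]_(n1, n0) * 'cV[R]_n1 * params n1 hidden')%type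
  else ('M[R]_(1, n0) * 'cV[R]_1)%type.

Fixpoint realization (n0 : nat) (hidden : seq nat) :
    params n0 hidden -> 'cV[R]_n0 -> R :=
  match hidden with
  | [::] => fun theta x => (theta.1 *m x + theta.2) 0 0
  | n1 :: hidden' => fun theta x =>
      realization theta.2 (map_mx swish (theta.1.1 *m x + theta.1.2))
  end.

(* The norm of a matrix is the maximum of the absolute values of its entries,
   hence this is the maximum over all entries of all A_l and B_l. *)
Fixpoint params_norm (n0 : nat) (hidden : seq nat) : params n0 hidden -> R :=
  match hidden with
  | [::] => fun theta => Num.max `|theta.1| `|theta.2|
  | n1 :: hidden' => fun theta =>
      Num.max (Num.max `|theta.1.1| `|theta.1.2|) (params_norm theta.2)
  end.

(* A function on [a, b]^d is represented by its extension by 0. *)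
Definition hypothesis_class (a b : R) (d : nat) (hidden : seq nat) (r : R) :
    set (d.-tuple R -> R) :=
  [set f | exists2 theta : params d hidden, params_norm theta <= r &
    f = (fun x => realization theta (\col_i tnth x i)) \_ (closed_box a b d)].

End networks.
Arguments hypothesis_class {R} a b d hidden r.

Section learning.
Variables (R : realType) (a b : R) (d D : nat) (F : (d + D).-tuple R -> R).

Definition input (u : (d + D).-tuple R) : d.-tuple R :=
  [tuple a + (b - a) * tnth u (lshift D i) | i < d].

Definition risk (disp : measure_display) (Omega : measurableType disp)
    (P : probability Omega R) (U : Omega -> (d + D).-tuple R)
    (f : d.-tuple R -> R) : \bar R :=
  'E_P[fun w => (f (input (U w)) - F (U w)) ^+ 2].

(* The sample is indexed from 0. *)
Definition empirical_risk (n : nat) (u : nat -> (d + D).-tuple R)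
    (f : d.-tuple R -> R) : R :=
  n%:R^-1 * \sum_(i < n) (f (input (u i)) - F (u i)) ^+ 2.

End learning.

Definition is_argmin (disp : Order.disp_t) (V : porderType disp) (T : Type)
    (H : set T) (J : T -> V) (f : T) : Prop :=
  H f /\ forall g, H g -> (J f <= J g)%O.

(* [fine] maps infinite values to 0, hence the first conjunct. *)
Definition eventually_bigO (R : realType) (e : nat -> \bar R)
    (rate : nat -> R) : Prop :=
  (\forall n \near \oo, e n \is a fin_num) /\ (fine \o e) =O_\oo rate.

(* Main.v *)
Require Import Defs.
From HB Require Import structures.
From mathcomp Require Import all_boot all_order all_algebra.
From mathcomp Require Import finmap.
From mathcomp Require Import all_classical all_reals all_analysis.
From mathcomp Require Import measurable_realfun.
From mathcomp Require Import ring lra.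
Import Order.TTheory GRing.Theory Num.Theory.
Import numFieldNormedType.Exports.
Import HBNNSimple.

(** The argument is a uniform deviation bound for the differences of losses
    between two hypotheses.  Write nu for the law of U, nu_n for the
    empirical measure of the sample, s = sqrt n, and
    q = (f - F)^2 - (f0 - F)^2 with f = f_{n,H} and f0 = f_H.  Since f minimizes
    the empirical risk, nu_n q <= 0, so the excess risk nu q is at most
    (nu - nu_n) q.

    The square F^2 cancels in q = f^2 - f0^2 - 2 (f - f0) F, and hypotheses are
    uniformly bounded, so q is square integrable as soon as F is.  Networks are
    Lipschitz in their parameters on the input box, so a grid of parameters of
    step of order 1/n gives a net of (n+1)^p functions ([hypothesis_class_net]), and
    replacing f, f0 by elements of the net and F by its truncation z at height
    s turns q into one of finitely many functions g with |g| <= C s and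
    nu g^2 <= C, at the price of an error of order (1 + F^2) / s
    ([square_loss_diff_approx], [approx_loss_bounds]).

    For such g and lam of order 1 / s the variables lam g are bounded by 1/4,
    and expanding the exponential to second order bounds the Laplace transform
    of lam n (nu - nu_n) g by a constant ([expectation_expR_deviation]; this is
    where independence enters, through [expectation_prod]).  Hence the maximum
    of (nu - nu_n) g over N functions has expectation at most of order
    (1 + ln N) / s ([expectation_selected_mean_le]).  With N = (n+1)^(2p) this
    gives an excess risk of order (1 + ln n) / sqrt n, which is
    O(n^(-1/2 + t)) for every t > 0 ([expected_excess_rate]).  The two claims are
    the cases t = B_1 + ... + B_(d+D) and t = eps. *)

Set Implicit Arguments.
Unset Strict Implicit.
Unset Printing Implicit Defensive.

Local Open Scope classical_set_scope.
Local Open Scope ring_scope.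

(** * Two inequalities for the exponential *)

(** Inverting 1 - x <= exp(- x) gives exp x <= 1 / (1 - x), and
    (1 + x + 2 x^2) (1 - x) = 1 + x^2 (1 - 2 x) >= 1 for x <= 1/2. *)
Lemma expR_le_quadratic (R : realType) (x : R) :
  `|x| <= 2^-1 -> expR x <= 1 + x + 2 * x ^+ 2.
Proof.
rewrite ler_norml => /andP[xge xle].
have x1 : 0 < 1 - x by lra.
have le_inv : expR x <= (1 - x)^-1.
  rewrite -[expR x]invrK -expRN lef_pV2 ?posrE ?expR_gt0//.
  exact: (expR_ge1Dx (- x)).
apply: (le_trans le_inv); rewrite -div1r ler_pdivrMr//.
have -> : (1 + x + 2 * x ^+ 2) * (1 - x) = 1 + x ^+ 2 * (1 - 2 * x) by ring.
by rewrite lerDl; apply: mulr_ge0; [exact: sqr_ge0|lra].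
Qed.

(** A maximal inequality that holds pointwise, so that it can be integrated
    without any convexity argument: it is 1 + t <= exp t at
    t = s j - ln #|J|, the right-hand side being enlarged to the whole sum. *)
Lemma le_ln_card_sum_expR (R : realType) (J : finType) (s : J -> R) (j : J) :
  s j <= ln #|J|%:R + #|J|%:R^-1 * \sum_k expR (s k).
Proof.
have J0 : 0 < #|J|%:R :> R by rewrite ltr0n; apply/card_gt0P; exists j.
have : s j - ln #|J|%:R <= expR (s j - ln #|J|%:R).
  by apply: le_trans (expR_ge1Dx _); rewrite lerDr.
rewrite lerBlDl => /le_trans; apply; rewrite lerD2l expRB lnK ?posrE//.
rewrite mulrC; apply: ler_wpM2l; first by rewrite invr_ge0 ltW.
rewrite (bigD1 j)//= lerDl; apply: sumr_ge0 => k _; exact: expR_ge0.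
Qed.

(** * Expectation of a product of independent variables *)

(** Both sides are linear in g and commute with increasing limits, so it is
    enough to know the identity for indicators.  The weight W will be the product
    of all the variables but one. *)
Lemma ge0_integral_weight_indic (R : realType) (d d' : measure_display)
    (T : measurableType d) (T' : measurableType d') (P : probability T R)
    (W : T -> R) (X : {RV P >-> T'}) (c : \bar R) :
  measurable_fun setT W -> (forall w, 0 <= W w) -> (0 <= c)%E -> c \is a fin_num ->
  (forall A, measurable A ->
     (\int[P]_w (W w * \1_A (X w))%:E = c * \int[P]_w (\1_A (X w))%:E)%E) ->
  forall g : T' -> R, measurable_fun setT g -> (forall x, 0 <= g x) ->
    (\int[P]_w (W w * g (X w))%:E = c * \int[P]_w (g (X w))%:E)%E.
Proof.
move=> mW W0 c0 cfin WX g mg g0.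
have mXf (f : T' -> R) : measurable_fun setT f ->
    measurable_fun setT (fun w => f (X w)).
  by move=> mf; exact: measurableT_comp.
have mEg : measurable_fun setT (EFin \o g) by exact/measurable_EFinP.
have Eg0 x : setT x -> (0 <= (EFin \o g) x)%E by rewrite /= lee_fin.
pose h := nnsfun_approx measurableT mEg.
have nd_h := nd_nnsfun_approx measurableT mEg.
have cvg_h x : (h n x)%:E @[n --> \oo] --> (g x)%:E.
  exact: (cvg_nnsfun_approx measurableT mEg Eg0).
have WXh n : (\int[P]_w (W w * h n (X w))%:E =
              c * \int[P]_w (h n (X w))%:E)%E.
  set s := fset_set (h n @` setT).
  have s0 (i : 'I_#|` s|) : 0 <= s`_i.
    have : s`_i \in s by rewrite mem_nth.
    by rewrite in_fset_set// inE => -[x _ <-].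
  have mA (y : R) : measurable (h n @^-1` [set y]).
    exact: measurable_funPTI.
  have mI (y : R) : measurable_fun setT (fun w => \1_(h n @^-1` [set y]) (X w) : R).
    by apply: mXf; exact: measurable_indic.
  transitivity (\sum_(i < #|` s|)
      (s`_i)%:E * \int[P]_w (W w * \1_(h n @^-1` [set s`_i]) (X w))%:E)%E.
    under eq_integral => w _.
      rewrite (fimfunEord (h n)) mulr_sumr -sumEFin.
      under eq_bigr => i _ do rewrite mulrCA EFinM.
      over.
    rewrite ge0_integral_sum//.
    - apply: eq_bigr => i _; rewrite ge0_integralZl//.
      + by apply/measurable_EFinP; apply: measurable_funM => //; exact: mI.
      + by move=> w _; rewrite lee_fin mulr_ge0.
      + by rewrite lee_fin.
    - move=> i; apply/measurable_EFinP.
      apply: measurable_funM => //; apply: measurable_funM => //; exact: mI.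
    - by move=> i w _; rewrite lee_fin !mulr_ge0.
  under [in RHS]eq_integral => w _.
    rewrite (fimfunEord (h n)) -sumEFin.
    under eq_bigr => i _ do rewrite EFinM.
    over.
  rewrite ge0_integral_sum//.
  - rewrite ge0_sume_distrr; last first.
      move=> i _; apply: integral_ge0 => w _.
      by rewrite mule_ge0// lee_fin.
    apply: eq_bigr => i _; rewrite ge0_integralZl//.
    + by rewrite WX// muleCA.
    + by apply/measurable_EFinP; exact: mI.
    + by rewrite lee_fin.
  - move=> i; apply/measurable_EFinP.
    by apply: measurable_funM => //; exact: mI.
  - by move=> i w _; rewrite mule_ge0 ?lee_fin.
have -> : (\int[P]_w (W w * g (X w))%:E =
           lim (\int[P]_w (W w * h n (X w))%:E @[n --> \oo]))%E.
  have Wg w : setT w ->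
      (W w * g (X w))%:E = lim ((W w * h n (X w))%:E @[n --> \oo]).
    move=> _; apply/esym/cvg_lim => //.
    rewrite EFinM; under eq_fun do rewrite EFinM.
    by apply: cvgeZl => //; exact: cvg_h.
  under eq_integral => w _ do rewrite (Wg w)//.
  apply: monotone_convergence => //.
  - move=> n; apply/measurable_EFinP; apply: measurable_funM => //.
    by apply: mXf.
  - by move=> n w _; rewrite lee_fin mulr_ge0.
  - by move=> w _ m n mn; rewrite lee_fin ler_wpM2l//; exact/lefP/nd_h.
have hg w : setT w -> (g (X w))%:E = lim ((h n (X w))%:E @[n --> \oo]).
  by move=> _; apply/esym/cvg_lim => //; exact: cvg_h.
have cvgI : (\int[P]_w (h n (X w))%:E @[n --> \oo] -->
             \int[P]_w (g (X w))%:E)%E.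
  under [X in _ --> X]eq_integral => w _ do rewrite (hg w)//.
  apply: cvg_monotone_convergence => //.
  - by move=> n; apply/measurable_EFinP; apply: mXf.
  - by move=> n w _; rewrite lee_fin.
  - by move=> w _ m n mn; rewrite lee_fin; exact/lefP/nd_h.
under eq_fun do rewrite WXh.
by apply/cvg_lim => //; apply: cvgeZl.
Qed.

(** Independence is the case where every g i is an indicator; the indicators
    are then replaced by arbitrary functions one index at a time. *)
Lemma expectation_prod (R : realType) (d d' : measure_display)
    (T : measurableType d) (T' : measurableType d') (P : probability T R)
    (X : nat -> {RV P >-> T'}) (n : nat) (g : nat -> T' -> R) :
  mutually_independent X ->
  (forall i, measurable_fun setT (g i)) -> (forall i x, 0 <= g i x) ->
  (forall i, (\int[P]_w (g i (X i w))%:E)%E \is a fin_num) ->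
  (\int[P]_w (\prod_(i < n) g i (X i w))%:E
   = \prod_(i < n) \int[P]_w (g i (X i w))%:E)%E.
Proof.
move=> indX.
have mXf i (f : T' -> R) : measurable_fun setT f ->
    measurable_fun setT (fun w => f (X i w)).
  by move=> mf; exact: measurableT_comp.
(* The functions of index at least k are still indicators. *)
suff H k : forall g : nat -> T' -> R,
    (forall i, measurable_fun setT (g i)) -> (forall i x, 0 <= g i x) ->
    (forall i, (\int[P]_w (g i (X i w))%:E)%E \is a fin_num) ->
    (forall i, (k <= i < n)%N -> exists2 A, measurable A & g i = \1_A) ->
    (\int[P]_w (\prod_(i < n) g i (X i w))%:E
     = \prod_(i < n) \int[P]_w (g i (X i w))%:E)%E.
  move=> mg g0 gfin; apply: (H n) => // i.
  by move=> /andP[/leq_ltn_trans] /[apply]; rewrite ltnn.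
elim: k => [|k IH] {}g mg g0 gfin gA.
  have /choice[A AP] : forall i, exists A : set T',
      measurable A /\ ((i < n)%N -> g i = \1_A).
    move=> i; have [iltn|nlei] := ltnP i n; last by exists set0.
    by have [A mA gAi] := gA i iltn; exists A.
  have mA i : measurable (A i) by case: (AP i).
  have gE i : (i < n)%N -> g i = \1_(A i) by case: (AP i).
  have mXA i : measurable (X i @^-1` A i) by exact: measurable_funPTI.
  pose J := [fset i in iota 0 n]%fset.
  have memJ i : (i \in J) = (i < n)%N by rewrite !inE mem_iota.
  have mXJ : measurable (\bigcap_(i in [set` J]) X i @^-1` A i).
    by apply: bigcap_measurableType.
  transitivity (P (\bigcap_(i in [set` J]) X i @^-1` A i)).
    rewrite -[in RHS](setIT (\bigcap_(i in _) _)) -integral_indic//.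
    apply: eq_integral => w _; congr EFin; rewrite indicE.
    case: (boolP (w \in _)) => [/set_mem wJ|/negP wJ].
      rewrite big1// => i _; rewrite gE// indicE mem_set//.
      by apply: (wJ i); rewrite /= memJ.
    have [i iJ Ai] : exists2 i, (i < n)%N & ~ A i (X i w).
      apply: contrapT => nA; apply: wJ; apply/mem_set => i /=.
      rewrite memJ => iltn; apply: contrapT => Ai.
      by apply: nA; exists i.
    by rewrite (bigD1 (Ordinal iJ))//= gE// indicE memNset// mul0r.
  rewrite indX//.
  transitivity (\prod_(i < n) P (X i @^-1` A i))%E.
    rewrite -(big_mkord xpredT (fun i => P (X i @^-1` A i))) /index_iota subn0.
    apply: perm_big; apply: uniq_perm; rewrite ?fset_uniq ?iota_uniq//.
    by move=> i; rewrite !inE.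
  apply: eq_bigr => i _; rewrite gE//.
  by rewrite -[X in P X = _]setIT -integral_indic.
have [nlek|kltn] := leqP n k.
  apply: IH => // i /andP[ki iltn].
  by move: (leq_ltn_trans ki iltn); rewrite ltnNge nlek.
pose j := Ordinal kltn.
(* g' A is the family g with its k-th member replaced by the indicator of A. *)
pose g' (A : set T') i := if i == k then \1_A else g i.
have W0 w : 0 <= \prod_(i < n | i != j) g i (X i w) by exact: prodr_ge0.
have mW : measurable_fun setT (fun w => \prod_(i < n | i != j) g i (X i w)).
  under eq_fun => w do rewrite big_mkcond/=.
  apply: measurable_prod => i _.
  by case: (i != j); [exact: mXf|exact: measurable_cst].
have I0 i : (0 <= \int[P]_w (g i (X i w))%:E)%E.
  by apply: integral_ge0 => w _; rewrite lee_fin.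
rewrite [RHS](bigD1 j)//= muleC.
under eq_integral => w _ do rewrite (bigD1 j)//= mulrC.
apply: (@ge0_integral_weight_indic _ _ _ _ _ _ _ (X k) _ mW W0) => //.
- exact: prode_ge0.
- exact: prode_fin_num.
- move=> A mA.
  have g'k : g' A k = \1_A by rewrite /g' eqxx.
  have g'i (i : 'I_n) : i != j -> g' A i = g i by rewrite /g' -val_eqE => /negbTE ->.
  have mI : measurable_fun setT (\1_A : T' -> R) by exact: measurable_indic.
  have := IH (g' A); rewrite (bigD1 j)//= g'k.
  rewrite (eq_bigr (fun i : 'I_n => \int[P]_w (g i (X i w))%:E)%E); last first.
    by move=> i /g'i ->.
  rewrite muleC => <-.
  + apply: eq_integral => w _; rewrite [in RHS](bigD1 j)//= g'k mulrC.
    by congr (_ * _)%:E; apply: eq_bigr => i /g'i ->.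
  + by move=> i; rewrite /g'; case: ifP.
  + by move=> i x; rewrite /g'; case: ifP.
  + move=> i; rewrite /g'; case: ifP => // _.
    have mXA : measurable (X i @^-1` A) by exact: measurable_funPTI.
    have -> : (\int[P]_w (\1_A (X i w))%:E = P (X i @^-1` A))%E.
      by rewrite -[X in _ = P X]setIT -integral_indic.
    exact: fin_num_measure.
  + move=> i /andP[ki iltn]; rewrite /g'; case: eqVneq => [_|ik]; first by exists A.
    by apply: gA; rewrite iltn andbT ltn_neqAle eq_sym ik.
Qed.

(** * Exponential moments of the deviation of an empirical mean *)

Lemma ge0_integral_has_law (R : realType) (d d' : measure_display)
    (T : measurableType d) (T' : measurableType d') (P : probability T R)
    (X : {RV P >-> T'}) (nu : probability T' R) (f : T' -> \bar R) :
  has_law X nu -> measurable_fun setT f -> (forall x, 0 <= f x)%E ->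
  (\int[P]_w f (X w) = \int[nu]_x f x)%E.
Proof.
move=> lawX mf f0; rewrite -[LHS](ge0_integral_distribution X mf f0).
by apply: eq_measure_integral => A mA _; exact: lawX.
Qed.

Lemma bounded_integrable (R : realType) (d : measure_display)
    (T : measurableType d) (P : probability T R) (f : T -> R) (M : R) :
  measurable_fun setT f -> (forall x, `|f x| <= M) ->
  P.-integrable setT (EFin \o f).
Proof.
move=> mf fM; apply: measurable_bounded_integrable => //.
  by rewrite ltey_eq fin_num_measure.
exists M; split; first exact: num_real.
by move=> N MN x _; exact: le_trans (fM x) (ltW MN).
Qed.

(** The mean m of g also satisfies |m| <= 1/4, so |m - g| <= 1/2 and the
    exponential is at most 1 + (m - g) + 2 (m - g)^2.  The linear term integrates
    to 0 and the variance is at most the second moment. *)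
Lemma integral_expR_centered (R : realType) (d : measure_display)
    (T : measurableType d) (nu : probability T R) (g : T -> R) (v : R) :
  measurable_fun setT g -> (forall x, `|g x| <= 4^-1) ->
  (\int[nu]_x (g x ^+ 2)%:E <= v%:E)%E ->
  (\int[nu]_x (expR (\int[nu]_y g y - g x))%:E <= (expR (2 * v))%:E)%E.
Proof.
move=> mg g4 gv; set m := Rintegral _ _ _.
have ig : nu.-integrable setT (EFin \o g) by exact: bounded_integrable g4.
have ig2 : nu.-integrable setT (EFin \o (fun x => g x ^+ 2)).
  apply: (bounded_integrable _ (M := 4^-1 ^+ 2)); first exact: measurable_funX.
  by move=> x; rewrite normrX ler_pXn2r// nnegrE.
have icst (c : R) : nu.-integrable setT (EFin \o (fun _ => c)).
  by apply: (bounded_integrable _ (M := `|c|)) => //; exact: measurable_cst.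
have Rcst (c : R) : (\int[nu]_x c) = c.
  rewrite -[RHS]mulr1 -[X in _ = _ * X]/(fine 1%E).
  rewrite -(@probability_setT _ _ _ nu); exact: Rintegral_cst.
have m4 : `|m| <= 4^-1.
  apply: le_trans (le_normr_Rintegral _ ig) _ => //.
  rewrite -[leRHS]Rcst; apply: le_Rintegral => //.
  exact: (integrable_norm ig).
pose q x := (1 + m + 2 * m ^+ 2) + (- (1 + 4 * m) * g x + 2 * g x ^+ 2).
have iq1 : nu.-integrable setT (EFin \o (fun x => - (1 + 4 * m) * g x)).
  exact: (integrableZl measurableT (- (1 + 4 * m)) ig).
have iq2 : nu.-integrable setT (EFin \o (fun x => 2 * g x ^+ 2)).
  exact: (integrableZl measurableT 2 ig2).
have iq12 : nu.-integrable setT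
    (EFin \o (fun x => - (1 + 4 * m) * g x + 2 * g x ^+ 2)).
  exact: (integrableD measurableT iq1 iq2).
have iq : nu.-integrable setT (EFin \o q).
  exact: (integrableD measurableT (icst _) iq12).
have mexp : measurable_fun setT (fun x => expR (m - g x)).
  apply: measurableT_comp => //.
  by apply: measurable_funB.
have le_q x : expR (m - g x) <= q x.
  have h : `|m - g x| <= 2^-1.
    by have := ler_normB m (g x); have := g4 x; move: m4; lra.
  apply: le_trans (expR_le_quadratic h) _.
  by rewrite le_eqVlt /q; apply/orP; left; apply/eqP; ring.
have : (\int[nu]_x (expR (m - g x))%:E <= \int[nu]_x (q x)%:E)%E.
  apply: ge0_le_integral => //.
  - by apply/measurable_EFinP.
  - exact: measurable_int iq.
  - by move=> x _; rewrite lee_fin.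
move/le_trans; apply.
have -> : (\int[nu]_x (q x)%:E = (\int[nu]_x q x)%:E)%E.
  by rewrite fineK//; exact: integrable_fin_num iq.
have v2 : \int[nu]_x (g x ^+ 2) <= v.
  by rewrite -lee_fin fineK//; exact: integrable_fin_num ig2.
rewrite lee_fin RintegralD// Rcst RintegralD// !RintegralZl// -/m.
apply: le_trans (expR_ge1Dx _).
by have := sqr_ge0 m; move: v2; nra.
Qed.

Lemma expectation_expR_deviation (R : realType) (d d' : measure_display)
    (T : measurableType d) (T' : measurableType d') (P : probability T R)
    (nu : probability T' R) (X : nat -> {RV P >-> T'}) (n : nat)
    (g : T' -> R) (v : R) :
  mutually_independent X -> (forall i, has_law (X i) nu) ->
  measurable_fun setT g -> (forall x, `|g x| <= 4^-1) ->
  (\int[nu]_x (g x ^+ 2)%:E <= v%:E)%E ->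
  (\int[P]_w (expR (\sum_(i < n) (\int[nu]_y g y - g (X i w))))%:E
   <= (expR (2 * v * n%:R))%:E)%E.
Proof.
move=> indX lawX mg g4 gv; set m := Rintegral _ _ _.
have mexp : measurable_fun setT (fun x => expR (m - g x)).
  apply: measurableT_comp => //.
  by apply: measurable_funB.
have E i : (\int[P]_w (expR (m - g (X i w)))%:E
            = \int[nu]_x (expR (m - g x))%:E)%E.
  apply: (ge0_integral_has_law (lawX i)) => [|x]; last by rewrite lee_fin expR_ge0.
  exact/measurable_EFinP.
have le_v := integral_expR_centered mg g4 gv; rewrite -/m in le_v.
have I0 : (0 <= \int[nu]_x (expR (m - g x))%:E)%E.
  by apply: integral_ge0 => x _; rewrite lee_fin expR_ge0.
under eq_integral => w _ do rewrite expR_sum.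
have Ifin : (\int[nu]_x (expR (m - g x))%:E)%E \is a fin_num.
  by rewrite ge0_fin_numE// (le_lt_trans le_v)// ltry.
rewrite (@expectation_prod _ _ _ _ _ _ _ n (fun _ x => expR (m - g x)) indX)//; last first.
  by move=> i; rewrite E.
under eq_bigr => i _ do rewrite E.
rewrite big_const_ord iter_mule mule1 -(fineK Ifin) -EFin_expe lee_fin expRM_natr.
by rewrite lerXn2r// ?nnegrE ?expR_ge0 ?fine_ge0// -lee_fin fineK.
Qed.

(** * Deviation of a function selected by the sample *)

(** The variable E w is the nu-mean of a function q, chosen after seeing the
    sample, whose empirical mean is nonpositive.  If q is within Phi / sqrt n of
    one of the finitely many functions g j, then E w is at most the deviation of
    g j plus the two means, over nu and over the sample, of Phi / sqrt n.  The
    deviation of g j is bounded, uniformly in j, by a quantity free of the random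
    choice of j ([le_ln_card_sum_expR]), whose expectation is controlled by the
    exponential moments.  The choice is made pointwise in w,
    since a minimizer over an infinite class has no reason to depend measurably
    on the sample. *)
Lemma expectation_selected_mean_le (R : realType) (d d' : measure_display)
    (T : measurableType d) (T' : measurableType d') (P : probability T R)
    (nu : probability T' R) (X : nat -> {RV P >-> T'}) (n : nat)
    (J : finType) (g : J -> T' -> R) (Phi : T' -> R) (C : R)
    (E : T -> \bar R) :
  (0 < n)%N -> mutually_independent X -> (forall i, has_law (X i) nu) ->
  0 < C -> (forall j, measurable_fun setT (g j)) ->
  (forall j x, `|g j x| <= C * Num.sqrt n%:R) ->
  (forall j, (\int[nu]_x (g j x ^+ 2)%:E <= C%:E)%E) ->
  measurable_fun setT Phi -> (forall x, 0 <= Phi x) ->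
  (\int[nu]_x (Phi x)%:E <= C%:E)%E ->
  measurable_fun setT E -> (forall w, 0 <= E w)%E ->
  (forall w, exists q j, [/\ measurable_fun setT q,
     (E w <= (\int[nu]_x q x)%:E)%E, \sum_(i < n) q (X i w) <= 0 &
     forall x, `|q x - g j x| <= Phi x / Num.sqrt n%:R]) ->
  (\int[P]_w E w <=
   ((2 * C + 4 * C * (ln #|J|%:R + expR (8 * C)^-1)) / Num.sqrt n%:R)%:E)%E.
Proof.
move=> n0 indX lawX C0 mg gC g2C mPhi Phi0 PhiC mE E0 EP.
have n0R : 0 < n%:R :> R by rewrite ltr0n.
set s := Num.sqrt n%:R.
have s0 : 0 < s by rewrite sqrtr_gt0.
have sn : n%:R = s * s by rewrite -expr2 sqr_sqrtr// ltW.
(* lam is as large as |lam g| <= 1/4 allows; then the second moment of lam g is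
   at most 1 / (16 C n), and the n factors multiply to a constant. *)
pose lam := (4 * C * s)^-1.
have lam0 : 0 < lam by rewrite invr_gt0 !mulr_gt0.
pose S j w := \sum_(i < n)
  (\int[nu]_y (lam * g j y) - lam * g j (X i w)).
have mlg j : measurable_fun setT (fun x => lam * g j x).
  by apply: measurable_funM => //; exact: measurable_cst.
have lg4 j x : `|lam * g j x| <= 4^-1.
  rewrite normrM gtr0_norm// /lam ler_pdivrMl ?mulr_gt0//.
  have -> : 4 * C * s * 4^-1 = C * s by field.
  exact: gC.
have lg2 j : (\int[nu]_x ((lam * g j x) ^+ 2)%:E <= ((16 * C * n%:R)^-1)%:E)%E.
  have mg2 : measurable_fun setT (fun x => (g j x ^+ 2)%:E).
    by apply/measurable_EFinP; exact: measurable_funX.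
  under eq_integral => x _ do rewrite exprMn EFinM.
  rewrite ge0_integralZl//; last 2 first.
  - by move=> x _; rewrite lee_fin sqr_ge0.
  - by rewrite lee_fin sqr_ge0.
  apply: (@le_trans _ _ ((lam ^+ 2)%:E * C%:E)%E).
    by apply: lee_wpmul2l; rewrite ?lee_fin ?sqr_ge0.
  rewrite -EFinM lee_fin le_eqVlt; apply/orP; left; apply/eqP.
  by rewrite /lam sn; field; rewrite !gt_eqF.
have expS j : (\int[P]_w (expR (S j w))%:E <= (expR (8 * C)^-1)%:E)%E.
  have := expectation_expR_deviation n indX lawX (mlg j) (lg4 j) (lg2 j).
  move=> /le_trans; apply; rewrite lee_fin ler_expR.
  rewrite le_eqVlt; apply/orP; left; apply/eqP.
  by field; rewrite !gt_eqF.
(* V dominates E and is a sum of nonnegative measurable terms. *)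
pose V w := (C / s + 4 * C / s * ln #|J|%:R) +
  ((n%:R * s)^-1 * \sum_(i < n) Phi (X i w) +
   4 * C / s * #|J|%:R^-1 * \sum_j expR (S j w)).
have EV w : (E w <= (V w)%:E)%E.
  have [q [j [mq /le_trans + qX qg]]] := EP w; apply.
  have ig : nu.-integrable setT (EFin \o g j) by exact: bounded_integrable (gC j).
  have iPhi : nu.-integrable setT (EFin \o Phi).
    apply/integrableP; split; first exact/measurable_EFinP.
    under eq_integral => x _ do rewrite /= ger0_norm//.
    by rewrite (le_lt_trans PhiC)// ltry.
  have iPhis : nu.-integrable setT (EFin \o (fun x => Phi x / s)).
    have -> : (fun x => Phi x / s) = (fun x => s^-1 * Phi x).
      by apply/funext => x; rewrite mulrC.
    exact: (integrableZl measurableT s^-1 iPhi).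
  have igP : nu.-integrable setT (EFin \o (fun x => g j x + Phi x / s)).
    exact: (integrableD measurableT ig iPhis).
  have qg' x : q x <= g j x + Phi x / s.
    by have := qg x; rewrite ler_distl => /andP[].
  have iq : nu.-integrable setT (EFin \o q).
    have igN : nu.-integrable setT (EFin \o (fun x => `|g j x| + Phi x / s)).
      exact: (integrableD measurableT (integrable_norm ig) iPhis).
    apply: (le_integrable _ _ _ igN) => //; first exact/measurable_EFinP.
    move=> x _ /=; rewrite lee_fin (ger0_norm (addr_ge0 _ _))//; last first.
      by rewrite divr_ge0// ltW.
    rewrite -[q x](subrK (g j x)) addrC (le_trans (ler_normD _ _))//.
    by rewrite lerD2l.
  have q_le : \int[nu]_x q x <= \int[nu]_x g j x + C / s.
    apply: (@le_trans _ _ (\int[nu]_x (g j x + Phi x / s))).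
      by apply: le_Rintegral.
    rewrite RintegralD// lerD2l RintegralZr// ler_pM2r ?invr_gt0//.
    by rewrite -lee_fin fineK//; exact: integrable_fin_num iPhi.
  have g_le : \sum_(i < n) g j (X i w) <= s^-1 * \sum_(i < n) Phi (X i w).
    rewrite -[leRHS]add0r -lerBlDr (le_trans _ qX)// lerBlDr mulr_sumr -big_split.
    apply: ler_sum => i _ /=; rewrite mulrC -lerBlDr.
    by have := qg (X i w); rewrite distrC ler_distl => /andP[_]; rewrite lerBlDr.
  have S_le := le_ln_card_sum_expR (S ^~ w) j.
  have SE : S j w = lam * (n%:R * \int[nu]_x g j x - \sum_(i < n) g j (X i w)).
    rewrite /S sumrB RintegralZl// sumr_const card_ord -mulr_sumr mulrBr.
    by rewrite -mulrnAr mulr_natl.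
  rewrite lee_fin; apply: (le_trans q_le); rewrite /V.
  move: S_le g_le; rewrite SE.
  set L := ln _; set M := _ * \sum_k _; set G := \sum_(i < n) g j _.
  set F := \sum_(i < n) _; set I := Rintegral _ _ _ => S_le g_le.
  have {S_le} : n%:R * I - G <= 4 * C * s * (L + M).
    by move: S_le; rewrite /lam ler_pdivrMl ?mulr_gt0.
  rewrite lerBlDr => nI.
  have {}nI : I <= n%:R^-1 * (4 * C * s * (L + M) + s^-1 * F).
    by rewrite ler_pdivlMl// (le_trans nI)// lerD2l.
  have -> : C / s + 4 * C / s * L +
     ((n%:R * s)^-1 * F + 4 * C / s / #|J|%:R * \sum_j0 expR (S j0 w)) =
     n%:R^-1 * (4 * C * s * (L + M) + s^-1 * F) + C / s.
    rewrite -[4 * C / s / #|J|%:R * _]mulrA -/M sn.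
    by field; rewrite gt_eqF.
  by rewrite lerD2r.
have mPhiX i : measurable_fun setT (fun w => Phi (X i w)).
  exact: measurableT_comp.
have mS j : measurable_fun setT (fun w => expR (S j w)).
  apply: measurableT_comp => //; apply: measurable_sum => i.
  by apply: measurable_funB => //; exact: (measurableT_comp (mlg j)).
have [ns0 Cs0] : 0 <= (n%:R * s)^-1 /\ 0 <= 4 * C / s.
  by rewrite invr_ge0 divr_ge0 ?mulr_ge0// ltW.
have CsJ0 : 0 <= 4 * C / s * #|J|%:R^-1 by rewrite mulr_ge0.
have lnJ0 : 0 <= ln #|J|%:R :> R.
  by have [->|J0] := posnP #|J|; [rewrite ln0|rewrite ln_ge0// ler1n].
pose V1 w := (n%:R * s)^-1 * \sum_(i < n) Phi (X i w).
pose V2 w := 4 * C / s * #|J|%:R^-1 * \sum_j expR (S j w).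
have mV1 : measurable_fun setT V1.
  by apply: measurable_funM; [exact: measurable_cst|exact: measurable_sum].
have mV2 : measurable_fun setT V2.
  apply: measurable_funM; first exact: measurable_cst.
  by apply: measurable_sum => j; exact: mS.
have V10 w : 0 <= V1 w by rewrite mulr_ge0// sumr_ge0.
have V20 w : 0 <= V2 w by rewrite mulr_ge0// sumr_ge0// => j _; exact: expR_ge0.
have c0 : 0 <= C / s + 4 * C / s * ln #|J|%:R.
  by rewrite addr_ge0// ?mulr_ge0// ?invr_ge0 ltW.
have I1 : (\int[P]_w (V1 w)%:E <= (C / s)%:E)%E.
  under eq_integral => w _ do rewrite /V1 EFinM -sumEFin.
  rewrite ge0_integralZl//; last 2 first.
  - by apply: emeasurable_sum => i; exact/measurable_EFinP.
  - by move=> w _; rewrite sumEFin lee_fin sumr_ge0.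
  rewrite ge0_integral_sum//; last 2 first.
  - by move=> i; exact/measurable_EFinP.
  - by move=> i w _; rewrite lee_fin.
  apply: (@le_trans _ _ (((n%:R * s)^-1)%:E * \sum_(i < n) C%:E)%E).
    apply: lee_wpmul2l; first by rewrite lee_fin.
    apply: lee_sum => i _.
    rewrite (ge0_integral_has_law (lawX i) (f := EFin \o Phi))//.
    exact/measurable_EFinP.
  rewrite sumEFin -EFinM lee_fin sumr_const card_ord -mulr_natl.
  rewrite le_eqVlt; apply/orP; left; apply/eqP.
  by field; rewrite !gt_eqF.
have I2 : (\int[P]_w (V2 w)%:E <= (4 * C / s * expR (8 * C)^-1)%:E)%E.
  under eq_integral => w _ do rewrite /V2 EFinM -sumEFin.
  rewrite ge0_integralZl//; last 2 first.
  - by apply: emeasurable_sum => i; exact/measurable_EFinP.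
  - by move=> w _; rewrite sumEFin lee_fin sumr_ge0// => j _; exact: expR_ge0.
  rewrite ge0_integral_sum//; last by move=> i; exact/measurable_EFinP.
  apply: (@le_trans _ _
      ((4 * C / s * #|J|%:R^-1)%:E * \sum_(j : J) (expR (8 * C)^-1)%:E)%E).
    by apply: lee_wpmul2l; [rewrite lee_fin|exact: lee_sum].
  rewrite sumEFin -EFinM lee_fin sumr_const -[expR _ *+ _]mulr_natl mulrA ler_wpM2r ?expR_ge0//.
  rewrite -[leLHS]mulrA ler_piMr//.
  have [->|J0] := posnP #|J|; first by rewrite mulr0.
  by rewrite mulVf// pnatr_eq0 -lt0n.
apply: (@le_trans _ _ (\int[P]_w (V w)%:E)%E).
  apply: ge0_le_integral => //.
  by apply/measurable_EFinP/measurable_funD => //; exact: measurable_funD.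
have -> : (\int[P]_w (V w)%:E =
    (C / s + 4 * C / s * ln #|J|%:R)%:E +
    (\int[P]_w (V1 w)%:E + \int[P]_w (V2 w)%:E))%E.
  under eq_integral => w _ do rewrite /V !EFinD.
  rewrite ge0_integralD//.
  - congr (_ + _)%E.
      rewrite -[RHS]mule1 -(@probability_setT _ _ _ P); exact: integral_cst.
    rewrite ge0_integralD//.
    + by move=> w _; rewrite lee_fin; exact: V10.
    + exact/measurable_EFinP.
    + by move=> w _; rewrite lee_fin; exact: V20.
    + exact/measurable_EFinP.
  - by move=> w _; rewrite adde_ge0// lee_fin; [exact: V10|exact: V20].
  - by apply/measurable_EFinP; exact: measurable_funD.
apply: (@le_trans _ _ ((C / s + 4 * C / s * ln #|J|%:R)%:E +
    ((C / s)%:E + (4 * C / s * expR (8 * C)^-1)%:E))%E).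
  by apply: leeD2l; exact: leeD.
rewrite -!EFinD lee_fin le_eqVlt; apply/orP; left; apply/eqP.
by field; rewrite gt_eqF.
Qed.

(** * Finite nets of networks *)

Lemma mx_norm_leP (R : realType) (m n : nat) (A : 'M[R]_(m, n)) (c : R) :
  0 <= c -> (`|A| <= c <-> forall i j, `|A i j| <= c).
Proof.
move=> c0; rewrite -[ `|A| ]/(mx_norm A) mx_normrE; split.
  by move=> /bigmax_leP[_ h] i j; exact: (h (i, j)).
by move=> h; apply/bigmax_leP; split => // -[i j] _ /=; exact: h.
Qed.

Lemma mx_norm_entry (R : realType) (m n : nat) (A : 'M[R]_(m, n)) i j :
  `|A i j| <= `|A|.
Proof. exact: ((mx_norm_leP A (normr_ge0 A)).1 (lexx _)). Qed.

Lemma swish_norm_le (R : realType) (x : R) : `|swish x| <= `|x|.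
Proof.
have e0 := expR_gt0 (- x).
have e1 : 0 < 1 + expR (- x) by rewrite addr_gt0.
rewrite /swish normrM ler_piMr// gtr0_norm ?invr_gt0//.
by rewrite invf_le1// lerDl ltW.
Qed.

(** With a = exp(- x) and b = exp(- y), y <= x, the difference is
    (b - a) / ((1 + a) (1 + b)), and b - a <= b (x - y) because
    a = b exp(- (x - y)) >= b (1 - (x - y)). *)
Lemma logistic_lipschitz (R : realType) (x y : R) :
  `|(1 + expR (- x))^-1 - (1 + expR (- y))^-1| <= `|x - y|.
Proof.
wlog yx : x y / y <= x.
  move=> H; have [/H//|/ltW/H] := leP y x.
  by rewrite distrC [leRHS]distrC.
have ex0 := expR_gt0 (- x); have ey0 := expR_gt0 (- y).
have le_e : expR (- x) <= expR (- y) by rewrite ler_expR lerN2.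
have ge_e : expR (- y) * (1 - (x - y)) <= expR (- x).
  have -> : - x = - y + - (x - y) by ring.
  rewrite expRD; apply: ler_wpM2l; first exact: ltW.
  exact: expR_ge1Dx.
set a := expR (- x) in ex0 le_e ge_e *; set b := expR (- y) in ey0 le_e ge_e *.
have -> : (1 + a)^-1 - (1 + b)^-1 = (b - a) / ((1 + a) * (1 + b)).
  by field; rewrite !gt_eqF ?addr_gt0.
have xy0 : 0 <= x - y by rewrite subr_ge0.
have ab0 : 0 < (1 + a) * (1 + b) by rewrite mulr_gt0 ?addr_gt0.
have ba0 : 0 <= b - a by rewrite subr_ge0.
rewrite (ger0_norm xy0) ger0_norm; last by rewrite divr_ge0// ltW.
rewrite ler_pdivrMr//.
have : 0 <= (x - y) * (1 + a + a * b).
  by rewrite mulr_ge0// addr_ge0// ?addr_ge0 ?mulr_ge0// ltW.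
nra.
Qed.

(** The swish of z is z times the logistic function of z; the constant grows
    with y only through the derivative of the second factor, which is enough
    since layers have bounded outputs. *)
Lemma swish_lipschitz (R : realType) (c x y : R) : `|y| <= c ->
  `|swish x - swish y| <= (1 + c) * `|x - y|.
Proof.
move=> yc; pose s (z : R) := (1 + expR (- z))^-1.
have s1 : `|s x| <= 1.
  have e0 := expR_gt0 (- x).
  have e1 : 0 < 1 + expR (- x) by rewrite addr_gt0.
  by rewrite /s gtr0_norm ?invr_gt0// invf_le1// lerDl ltW.
have -> : swish x - swish y = s x * (x - y) + y * (s x - s y).
  by rewrite /swish -/(s x) -/(s y); ring.
rewrite (le_trans (ler_normD _ _))// mulrDl mul1r !normrM.
apply: lerD; first by rewrite ler_piMl.
by apply: ler_pM => //; exact: logistic_lipschitz.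
Qed.

Lemma mulmx_norm_le (R : realType) (m n : nat) (A : 'M[R]_(m, n))
    (x : 'cV[R]_n) (r c : R) :
  `|A| <= r -> `|x| <= c -> `|A *m x| <= n%:R * (r * c).
Proof.
move=> Ar xc.
have r0 : 0 <= r by apply: le_trans Ar.
have c0 : 0 <= c by apply: le_trans xc.
apply/mx_norm_leP; first by rewrite !mulr_ge0.
move=> i j; rewrite mxE; apply: (le_trans (ler_norm_sum _ _ _)).
rewrite mulr_natl -[X in _ *+ X]card_ord -sumr_const; apply: ler_sum => k _.
rewrite normrM; apply: ler_pM => //.
  exact: le_trans (mx_norm_entry _ _ _) Ar.
exact: le_trans (mx_norm_entry _ _ _) xc.
Qed.

Lemma affine_norm_le (R : realType) (m n : nat) (A : 'M[R]_(m, n))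
    (b : 'cV[R]_m) (x : 'cV[R]_n) (r c : R) :
  `|A| <= r -> `|b| <= r -> `|x| <= c -> `|A *m x + b| <= n%:R * (r * c) + r.
Proof.
move=> Ar br xc; apply: (le_trans (ler_normD _ _)); apply: lerD => //.
exact: mulmx_norm_le.
Qed.

Lemma affine_dist_le (R : realType) (m n : nat) (A A' : 'M[R]_(m, n))
    (b b' : 'cV[R]_m) (x x' : 'cV[R]_n) (r c e del : R) :
  `|A| <= r -> `|x'| <= c -> `|A - A'| <= e -> `|b - b'| <= e ->
  `|x - x'| <= del ->
  `|(A *m x + b) - (A' *m x' + b')| <= n%:R * (r * del) + (n%:R * (e * c) + e).
Proof.
move=> Ar xc Ae be xd.
have -> : (A *m x + b) - (A' *m x' + b') =
          A *m (x - x') + ((A - A') *m x' + (b - b')).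
  by rewrite mulmxBr mulmxBl !addrA subrK opprD !addrA [in LHS](addrAC _ b).
apply: (le_trans (ler_normD _ _)); apply: lerD; first exact: mulmx_norm_le.
exact: affine_norm_le.
Qed.

(** The bound of [affine_dist_le] for a grid of step 2 r / k, put in the shape
    (constant) * (del + 1 / k) that is stable under composition of layers. *)
Lemma affine_net_dist_le (R : realType) (m n : nat) (A A' : 'M[R]_(m, n))
    (b b' : 'cV[R]_m) (x x' : 'cV[R]_n) (r c del : R) (k : nat) :
  `|A| <= r -> `|x'| <= c ->
  `|A - A'| <= 2 * r / k%:R -> `|b - b'| <= 2 * r / k%:R -> `|x - x'| <= del ->
  `|(A *m x + b) - (A' *m x' + b')|
    <= (n%:R * r + 2 * r * (n%:R * c + 1)) * (del + k%:R^-1).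
Proof.
move=> Ar xc AA bb xx; apply: le_trans (affine_dist_le Ar xc AA bb xx) _.
have r0 : 0 <= r by apply: le_trans Ar.
have c0 : 0 <= c by apply: le_trans xc.
have d0 : 0 <= del by apply: le_trans xx.
have h : 0 <= n%:R * r * k%:R^-1 + 2 * r * (n%:R * c + 1) * del.
  by rewrite addr_ge0 ?mulr_ge0// addr_ge0 ?mulr_ge0.
rewrite -subr_ge0; congr (0 <= _): h; ring.
Qed.

Lemma grid_net (R : realType) (r x : R) (k : nat) :
  0 < r -> (0 < k)%N -> `|x| <= r ->
  exists j : 'I_k.+1, `|x - (- r + 2 * r * j%:R / k%:R)| <= 2 * r / k%:R.
Proof.
move=> r0 k0; rewrite ler_norml => /andP[rx xr].
have k0R : 0 < k%:R :> R by rewrite ltr0n.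
(* y is the position of x in units of the grid step, counted from - r. *)
pose y := (x + r) * k%:R / (2 * r).
have y0 : 0 <= y by rewrite divr_ge0 ?mulr_ge0//; lra.
have yk : y <= k%:R.
  by rewrite ler_pdivrMr ?mulr_gt0// mulrC ler_pM2l//; lra.
have /andP[ty yt] := truncn_itv y0.
have tk : (Num.trunc y < k.+1)%N.
  by rewrite -(ltr_nat R) (le_lt_trans ty)// (le_lt_trans yk)// ltr_nat.
exists (Ordinal tk) => /=.
have -> : x - (- r + 2 * r * (Num.trunc y)%:R / k%:R) =
    (2 * r / k%:R) * (y - (Num.trunc y)%:R).
  by rewrite /y; field; rewrite !gt_eqF.
have rk0 : 0 <= 2 * r / k%:R by rewrite divr_ge0 ?mulr_ge0// ltW.
rewrite normrM (ger0_norm rk0); apply: ler_piMr => //.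
by rewrite -natr1 in yt; rewrite ler_norml; lra.
Qed.

Lemma grid_bound (R : realType) (r : R) (k : nat) (j : 'I_k.+1) :
  0 < r -> (0 < k)%N -> `|- r + 2 * r * j%:R / k%:R| <= r.
Proof.
move=> r0 k0; have k0R : 0 < k%:R :> R by rewrite ltr0n.
have jk : j%:R / k%:R <= 1 :> R.
  by rewrite ler_pdivrMr// mul1r ler_nat -ltnS.
have j0 : 0 <= j%:R / k%:R :> R by rewrite divr_ge0.
by rewrite -mulrA ler_norml; nra.
Qed.

Lemma matrix_net (R : realType) (m n : nat) (r : R) (k : nat) :
  0 < r -> (0 < k)%N ->
  exists (I : finType) (g : I -> 'M[R]_(m, n)),
    [/\ (#|I| = k.+1 ^ (m * n))%N, forall i, `|g i| <= r &
    forall A, `|A| <= r -> exists i, `|A - g i| <= 2 * r / k%:R].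
Proof.
move=> r0 k0.
exists 'M['I_k.+1]_(m, n), (map_mx (fun j : 'I_k.+1 => - r + 2 * r * j%:R / k%:R)).
split; first by rewrite card_mx card_ord.
  by move=> i; apply/mx_norm_leP; rewrite ?ltW// => a b; rewrite mxE grid_bound.
move=> A Ar.
have /choice[h hP] : forall ij : 'I_m * 'I_n, exists j : 'I_k.+1,
    `|A ij.1 ij.2 - (- r + 2 * r * j%:R / k%:R)| <= 2 * r / k%:R.
  by move=> ij; apply: grid_net => //; exact: le_trans (mx_norm_entry _ _ _) Ar.
exists (\matrix_(i, j) h (i, j)).
apply/mx_norm_leP => [|i j]; first by rewrite divr_ge0 ?mulr_ge0// ltW.
by rewrite !mxE; exact: (hP (i, j)).
Qed.

(** The number of scalar parameters of a network. *)
Fixpoint net_exponent (n0 : nat) (hidden : seq nat) : nat :=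
  if hidden is n1 :: hidden' then
    (n1 * n0 + n1 * 1 + net_exponent n1 hidden')%N
  else (1 * n0 + 1 * 1)%N.

Lemma realization_bounded (R : realType) (n0 : nat) (hidden : seq nat)
    (r c : R) :
  exists M : R, forall (theta : params R n0 hidden) (x : 'cV[R]_n0),
    params_norm theta <= r -> `|x| <= c -> `|realization theta x| <= M.
Proof.
elim: hidden n0 c => [|n1 hidden IH] n0 c.
  exists (n0%:R * (r * c) + r) => -[A b] x /=; rewrite ge_max => /andP[Ar br] xc.
  exact: le_trans (mx_norm_entry _ _ _) (affine_norm_le Ar br xc).
have [M MP] := IH n1 (n0%:R * (r * c) + r).
exists M => -[[A b] theta] x /=; rewrite !ge_max => /andP[/andP[Ar br] thr] xc.
apply: MP => //.
have h := affine_norm_le Ar br xc.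
apply/mx_norm_leP; first exact: le_trans h.
move=> i j; rewrite mxE (le_trans (swish_norm_le _))//.
exact: le_trans (mx_norm_entry _ _ _) h.
Qed.

(** A grid for each matrix and bias vector, propagated through the layers.  The
    induction needs two different inputs x and x', because the inputs of the
    deeper layers are the outputs of two different first layers. *)
Lemma realization_net (R : realType) (n0 : nat) (hidden : seq nat) (r c : R) :
  0 < r -> 0 <= c ->
  exists2 K : R, 0 <= K & forall k : nat, (0 < k)%N ->
  exists (I : finType) (g : I -> params R n0 hidden),
    [/\ (#|I| = k.+1 ^ net_exponent n0 hidden)%N,
     forall i, params_norm (g i) <= r &
     forall theta : params R n0 hidden, params_norm theta <= r -> exists i,
       forall (x x' : 'cV[R]_n0) (del : R), 0 <= del ->
         `|x| <= c -> `|x'| <= c -> `|x - x'| <= del ->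
         `|realization theta x - realization (g i) x'|
           <= K * (del + k%:R^-1)].
Proof.
move=> r0; elim: hidden n0 c => [|n1 hidden IH] n0 c c0.
  exists (n0%:R * r + 2 * r * (n0%:R * c + 1)) => [|k k0].
    by rewrite addr_ge0 ?mulr_ge0 ?addr_ge0 ?mulr_ge0// ltW.
  have [I [gA [cardI gAr gAnet]]] := matrix_net 1 n0 r0 k0.
  have [I' [gb [cardI' gbr gbnet]]] := matrix_net 1 1 r0 k0.
  exists (I * I')%type, (fun i => (gA i.1, gb i.2)); split.
  - by rewrite card_prod cardI cardI' -expnD.
  - by move=> i /=; rewrite ge_max gAr gbr.
  - move=> [A b] /=; rewrite ge_max => /andP[Ar br].
    have [i iP] := gAnet A Ar; have [i' iP'] := gbnet b br.
    exists (i, i') => x x' del del0 xc xc' xx' /=.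
    have h := affine_net_dist_le Ar xc' iP iP' xx'.
    set y := _ *m _ + _ in h *; set y' := _ *m x' + _ in h *.
    have -> : y 0 0 - y' 0 0 = (y - y') 0 0 by rewrite !mxE.
    exact: le_trans (mx_norm_entry _ _ _) h.
set c1 := n0%:R * (r * c) + r.
have c10 : 0 <= c1 by rewrite addr_ge0 ?mulr_ge0// ltW.
have c11 : 0 <= 1 + c1 by rewrite addr_ge0.
have [K K0 KP] := IH n1 _ c10.
(* Ka is the constant of the first affine map, 1 + c1 that of the activation. *)
set Ka := n0%:R * r + 2 * r * (n0%:R * c + 1).
have Ka0 : 0 <= Ka.
  by rewrite addr_ge0 ?mulr_ge0 ?addr_ge0 ?mulr_ge0// ltW.
exists (K * ((1 + c1) * Ka + 1)) => [|k k0].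
  by rewrite mulr_ge0// addr_ge0// mulr_ge0.
have [I [gA [cardI gAr gAnet]]] := matrix_net n1 n0 r0 k0.
have [I' [gb [cardI' gbr gbnet]]] := matrix_net n1 1 r0 k0.
have [I'' [gt [cardI'' gtr gtnet]]] := KP k k0.
exists (I * I' * I'')%type, (fun i => (gA i.1.1, gb i.1.2, gt i.2)); split.
- by rewrite !card_prod cardI cardI' cardI'' -!expnD.
- by move=> i /=; rewrite !ge_max gAr gbr gtr.
- move=> [[A b] theta] /=; rewrite !ge_max => /andP[/andP[Ar br] tr].
  have [i iP] := gAnet A Ar; have [i' iP'] := gbnet b br.
  have [i'' iP''] := gtnet theta tr.
  exists (i, i', i'') => x x' del del0 xc xc' xx' /=.
  have h := affine_net_dist_le Ar xc' iP iP' xx'; rewrite -/Ka in h.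
  have hy := affine_norm_le Ar br xc.
  have hy' := affine_norm_le (gAr i) (gbr i') xc'.
  move: h hy hy'; move: (_ *m x + _) (_ *m x' + _) => y y' h hy hy'.
  have k1 : 0 <= k%:R^-1 :> R by rewrite invr_ge0.
  have del1 : 0 <= (1 + c1) * (Ka * (del + k%:R^-1)).
    by rewrite mulr_ge0// mulr_ge0// addr_ge0.
  have swish_le (z : 'cV[R]_n1) : `|z| <= c1 -> `|map_mx (@swish R) z| <= c1.
    move=> zc; apply/mx_norm_leP => // a b'; rewrite mxE.
    apply: le_trans (swish_norm_le _) _.
    exact: le_trans (mx_norm_entry _ _ _) zc.
  apply: le_trans (iP'' _ _ _ del1 (swish_le _ hy) (swish_le _ hy') _) _.
    apply/mx_norm_leP => // a b'; rewrite !mxE.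
    apply: le_trans (swish_lipschitz (c := c1) _ _) _.
      exact: le_trans (mx_norm_entry _ _ _) hy'.
    apply: ler_wpM2l; first by rewrite addr_ge0.
    have -> : y a b' - y' a b' = (y - y') a b' by rewrite !mxE.
    exact: le_trans (mx_norm_entry _ _ _) h.
  rewrite -mulrA; apply: ler_wpM2l => //.
  by rewrite [leRHS]mulrDl mul1r mulrA lerD2l lerDr.
Qed.

Lemma measurable_swish (R : realType) : measurable_fun setT (@swish R).
Proof.
apply: continuous_measurable_fun => x; apply: cvgM; first exact: cvg_id.
apply: cvgV; first by rewrite gt_eqF// addr_gt0// expR_gt0.
apply: cvgD; first exact: cvg_cst.
apply: (@continuous_comp _ _ _ -%R (@expR R)); first exact: opp_continuous.
exact: continuous_expR.
Qed.

Lemma measurable_realization (R : realType) (d : measure_display)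
    (T : measurableType d) (n0 : nat) (hidden : seq nat)
    (theta : params R n0 hidden) (X : T -> 'cV[R]_n0) :
  (forall i, measurable_fun setT (fun t => X t i 0)) ->
  measurable_fun setT (fun t => realization theta (X t)).
Proof.
have affine m n (A : 'M[R]_(m, n)) (b : 'cV[R]_m) (Y : T -> 'cV[R]_n) i :
    (forall i, measurable_fun setT (fun t => Y t i 0)) ->
    measurable_fun setT (fun t => (A *m Y t + b) i 0).
  move=> mY; under eq_fun do rewrite mxE mxE.
  apply: measurable_funD; last exact: measurable_cst.
  apply: measurable_sum => j; apply: measurable_funM => //.
elim: hidden n0 theta X => [|n1 hidden IH] n0.
  by move=> [A b] X mX; exact: affine.
move=> [[A b] theta] X mX /=; apply: IH => i.
under eq_fun do rewrite mxE.
apply: (measurableT_comp (@measurable_swish R)); exact: affine.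
Qed.

(** * Square loss and truncation *)

Definition clamp (R : realType) (s y : R) : R := Num.max (- s) (Num.min y s).

Lemma clamp_norm_le (R : realType) (s y : R) : 0 <= s ->
  `|clamp s y| <= s /\ `|clamp s y| <= `|y|.
Proof.
move=> s0; rewrite /clamp.
have [ys|sy] := leP y s; have [sy'|ys'] := leP (- s) _; rewrite ?normrN.
- by rewrite ler_norml sy' ys.
- by rewrite ger0_norm//; split => //; rewrite ltr0_norm; lra.
- by rewrite ger0_norm//; split => //; rewrite gtr0_norm; lra.
- by lra.
Qed.

(** The error vanishes for |y| <= s and is at most |y| <= y^2 / s otherwise: a
    second moment makes truncation at height s cost only 1 / s in mean. *)
Lemma clamp_dist_le (R : realType) (s y : R) : 0 < s ->
  `|y - clamp s y| <= y ^+ 2 / s.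
Proof.
move=> s0; rewrite /clamp ler_pdivlMr//.
have y2 : 0 <= y ^+ 2 by exact: sqr_ge0.
have [ys|sy] := leP y s; have [sy'|ys'] := leP (- s) _.
- by rewrite subrr normr0 mul0r.
- by rewrite ltr0_norm; [nra|lra].
- by rewrite gtr0_norm; [nra|lra].
- lra.
Qed.

Lemma measurable_clamp (R : realType) (s : R) : measurable_fun setT (@clamp R s).
Proof.
apply: measurable_maxr => //; apply: measurable_minr => //.
Qed.

(** The error is that of replacing the hypotheses f, f0 by h, h0 and the output
    y by its truncation z.  Errors linear in |y| are absorbed through
    |y| <= 1 + y^2, so that only the second moment of the output matters. *)
Lemma square_loss_diff_approx (R : realType) (f f0 h h0 y z M K s : R) :
  0 < s -> 0 <= K ->
  `|f| <= M -> `|f0| <= M -> `|h| <= M -> `|h0| <= M ->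
  `|f - h| <= K / s -> `|f0 - h0| <= K / s -> `|y - z| <= y ^+ 2 / s ->
  `|((f - y) ^+ 2 - (f0 - y) ^+ 2) - (h ^+ 2 - h0 ^+ 2 - 2 * (h - h0) * z)|
    <= ((4 * M * K + 4 * K) + (4 * K + 4 * M) * y ^+ 2) / s.
Proof.
move=> s0 K0 fM f0M hM h0M fh f0h yz.
have M0 : 0 <= M by apply: le_trans fM.
have -> : ((f - y) ^+ 2 - (f0 - y) ^+ 2) - (h ^+ 2 - h0 ^+ 2 - 2 * (h - h0) * z)
  = (f - h) * (f + h - 2 * y) - (f0 - h0) * (f0 + h0 - 2 * y)
    - 2 * (h - h0) * (y - z) by ring.
have y1 : `|y| <= 1 + y ^+ 2.
  have := sqr_ge0 (`|y| - 1); have := sqr_ge0 `|y|; rewrite -[y ^+ 2]real_normK ?num_real//.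
  nra.
have H (p q : R) : `|p| <= M -> `|q| <= M -> `|p - q| <= K / s ->
    `|(p - q) * (p + q - 2 * y)| <= K / s * (2 * M + 2 * (1 + y ^+ 2)).
  move=> pM qM pq; rewrite normrM; apply: ler_pM => //.
  rewrite (le_trans (ler_normB _ _))//; apply: lerD.
    by rewrite (le_trans (ler_normD _ _))//; lra.
  by rewrite normrM (ger0_norm (ler0n _ 2)) ler_pM2l.
have H' : `|2 * (h - h0) * (y - z)| <= (4 * M) * (y ^+ 2 / s).
  rewrite normrM; apply: ler_pM => //.
  by rewrite normrM (ger0_norm (ler0n _ 2)) (le_trans (ler_wpM2l _ (ler_normB _ _)))//; lra.
have H1 := H _ _ fM hM fh; have H2 := H _ _ f0M h0M f0h.
apply: (le_trans (ler_normB _ _)); apply: (le_trans (lerD (ler_normB _ _) H')).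
apply: (le_trans (lerD (lerD H1 H2) (lexx _))).
by rewrite le_eqVlt; apply/orP; left; apply/eqP; field; rewrite gt_eqF.
Qed.

(** The truncation height s enters the uniform bound only: in the second
    moment, |z| is bounded by |y|. *)
Lemma approx_loss_bounds (R : realType) (h h0 y z M s : R) :
  1 <= s -> `|h| <= M -> `|h0| <= M -> `|z| <= s -> `|z| <= `|y| ->
  `|h ^+ 2 - h0 ^+ 2 - 2 * (h - h0) * z| <= (2 * M ^+ 2 + 4 * M) * s /\
  (h ^+ 2 - h0 ^+ 2 - 2 * (h - h0) * z) ^+ 2
    <= 8 * M ^+ 4 + 32 * M ^+ 2 * y ^+ 2.
Proof.
move=> s1 hM h0M zs zy.
have M0 : 0 <= M by apply: le_trans hM.
have a2 : `|h ^+ 2 - h0 ^+ 2| <= 2 * M ^+ 2.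
  rewrite (le_trans (ler_normB _ _))// !normrX mulr_natl mulr2n.
  by apply: lerD; rewrite lerXn2r// nnegrE.
have b2 : `|2 * (h - h0)| <= 4 * M.
  by rewrite normrM (ger0_norm (ler0n _ 2)) (le_trans (ler_wpM2l _ (ler_normB _ _)))//; lra.
have bz (t : R) : `|z| <= t -> `|2 * (h - h0) * z| <= 4 * M * t.
  by move=> zt; rewrite normrM; apply: ler_pM.
split.
  apply: (le_trans (ler_normB _ _)); rewrite [leRHS]mulrDl; apply: lerD; last exact: bz.
  by apply: le_trans a2 _; rewrite ler_peMr// mulr_ge0// sqr_ge0.
set p := h ^+ 2 - h0 ^+ 2 in a2 *; set q := 2 * (h - h0) * z in bz *.
have p2 : p ^+ 2 <= (2 * M ^+ 2) ^+ 2.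
  by rewrite -real_normK ?num_real// lerXn2r ?nnegrE// mulr_ge0// sqr_ge0.
have q2 : q ^+ 2 <= 16 * M ^+ 2 * y ^+ 2.
  have -> : 16 * M ^+ 2 * y ^+ 2 = (4 * M * `|y|) ^+ 2.
    by rewrite exprMn real_normK ?num_real//; ring.
  by rewrite -real_normK ?num_real// lerXn2r ?nnegrE ?mulr_ge0//; exact: bz.
have : 0 <= (p + q) ^+ 2 by exact: sqr_ge0.
nra.
Qed.

(** * Excess risk of an empirical minimizer *)

(** The constant depends neither on n nor on the net, so the net can be refined
    as n grows.  The functions f and f0 stand for the empirical minimizer and the
    minimizer of the risk, both composed with the input map. *)
Lemma expected_excess_risk_le (R : realType) (d d' : measure_display)
    (T : measurableType d) (T' : measurableType d') (P : probability T R)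
    (nu : probability T' R) (X : nat -> {RV P >-> T'})
    (F : T' -> R) (M K : R) :
  mutually_independent X -> (forall i, has_law (X i) nu) ->
  measurable_fun setT F -> nu.-integrable setT (EFin \o (fun x => F x ^+ 2)) ->
  0 <= M -> 0 <= K ->
  exists C : R, [/\ 0 < C & forall (n : nat) (I : finType) (h : I -> T' -> R)
      (E : T -> \bar R),
    (0 < n)%N -> (forall i, measurable_fun setT (h i)) ->
    (forall i x, `|h i x| <= M) ->
    measurable_fun setT E -> (forall w, 0 <= E w)%E ->
    (forall w, exists f f0 : T' -> R, [/\ measurable_fun setT f, measurable_fun setT f0,
       (E w <= (\int[nu]_x ((f x - F x) ^+ 2 - (f0 x - F x) ^+ 2))%:E)%E,
       \sum_(i < n) (f (X i w) - F (X i w)) ^+ 2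
         <= \sum_(i < n) (f0 (X i w) - F (X i w)) ^+ 2 &
       [/\ forall x, `|f x| <= M, forall x, `|f0 x| <= M,
           exists i, forall x, `|f x - h i x| <= K / Num.sqrt n%:R &
           exists i, forall x, `|f0 x - h i x| <= K / Num.sqrt n%:R]]) ->
    (\int[P]_w E w <= (C * (1 + ln #|I|%:R) / Num.sqrt n%:R)%:E)%E].
Proof.
move=> indX lawX mF iF2 M0 K0.
pose A := \int[nu]_x (F x ^+ 2).
have A0 : 0 <= A by apply: Rintegral_ge0 => x _; exact: sqr_ge0.
have AE : (\int[nu]_x (F x ^+ 2)%:E = A%:E)%E.
  by rewrite fineK//; exact: integrable_fin_num iF2.
pose c1 := 4 * M * K + 4 * K; pose c2 := 4 * K + 4 * M.
pose c3 := 8 * M ^+ 4 + 32 * M ^+ 2 * A; pose c4 := 2 * M ^+ 2 + 4 * M.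
have [c10 c20] : 0 <= c1 /\ 0 <= c2 by rewrite !addr_ge0 ?mulr_ge0.
have c30 : 0 <= c3 by rewrite addr_ge0// ?mulr_ge0// exprn_ge0.
have c40 : 0 <= c4 by rewrite addr_ge0// ?mulr_ge0// exprn_ge0.
have c2A : 0 <= c2 * A by rewrite mulr_ge0.
pose C := 1 + c3 + c4 + (c1 + c2 * A).
have C0 : 0 < C by rewrite /C; lra.
have int_quad (p q : R) : 0 <= p -> 0 <= q ->
    (\int[nu]_x (p + q * F x ^+ 2)%:E = (p + q * A)%:E)%E.
  move=> p0 q0; under eq_integral => x _ do rewrite EFinD EFinM.
  have mF2 : measurable_fun setT (fun x => (F x ^+ 2)%:E).
    by apply/measurable_EFinP; exact: measurable_funX.
  rewrite ge0_integralD//.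
  - rewrite EFinD EFinM; congr (_ + _)%E.
      rewrite -[RHS]mule1 -(@probability_setT _ _ _ nu); exact: integral_cst.
    rewrite ge0_integralZl// ?AE// => x _; rewrite lee_fin sqr_ge0//.
  - by move=> x _; rewrite lee_fin mulr_ge0// sqr_ge0.
  - by apply: emeasurable_funM.
exists (2 * C + 8 * C * (1 + expR (8 * C)^-1)); split.
  by rewrite addr_gt0 ?mulr_gt0// addr_gt0 ?expR_gt0.
move=> n I h E n0 mh hM mE E0 EP.
have n1 : 1 <= n%:R :> R by rewrite ler1n.
set s := Num.sqrt n%:R.
have s1 : 1 <= s by rewrite -sqrtr1 ler_sqrt.
have s0 : 0 < s by lra.
(* Truncating at sqrt n balances the truncation error 1 / s against the bound
   |g| <= c4 s required by the exponential moments. *)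
pose z x := clamp s (F x).
have mz : measurable_fun setT z by apply: measurableT_comp => //; exact: measurable_clamp.
pose g (ij : I * I) x := h ij.1 x ^+ 2 - h ij.2 x ^+ 2
  - 2 * (h ij.1 x - h ij.2 x) * z x.
have zP x := clamp_norm_le (F x) (ltW s0).
have gP ij x : `|g ij x| <= c4 * s /\
    g ij x ^+ 2 <= 8 * M ^+ 4 + 32 * M ^+ 2 * F x ^+ 2.
  by have [z1 z2] := zP x; apply: approx_loss_bounds.
have mg ij : measurable_fun setT (g ij).
  apply: measurable_funB.
    by apply: measurable_funB; apply: measurable_funX.
  apply: measurable_funM => //; apply: measurable_funM => //.
  exact: measurable_funB.
pose Phi x := c1 + c2 * F x ^+ 2.
have mPhi : measurable_fun setT Phi.
  apply: measurable_funD => //; apply: measurable_funM => //.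
  exact: measurable_funX.
have Phi0 x : 0 <= Phi x by rewrite addr_ge0// mulr_ge0// sqr_ge0.
have := @expectation_selected_mean_le _ _ _ _ _ P nu X n _ g Phi C E n0 indX lawX C0 mg.
move=> H; apply: le_trans (H _ _ mPhi Phi0 _ mE E0 _) _.
- move=> ij x; apply: le_trans (gP ij x).1 _; rewrite ler_pM2r// /C; lra.
- move=> ij; apply: (@le_trans _ _
      (\int[nu]_x (8 * M ^+ 4 + 32 * M ^+ 2 * F x ^+ 2)%:E)%E).
    apply: ge0_le_integral => //.
    + by move=> x _; rewrite lee_fin sqr_ge0.
    + by apply/measurable_EFinP; exact: measurable_funX.
    + apply/measurable_EFinP; apply: measurable_funD => //.
      by apply: measurable_funM => //; exact: measurable_funX.
    + by move=> x _; rewrite lee_fin; exact: (gP ij x).2.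
  by rewrite int_quad ?mulr_ge0 ?exprn_ge0// lee_fin -/c3 /C; lra.
- by rewrite int_quad// lee_fin /C; lra.
- move=> w; have [f [f0 [mf mf0 Eq sum_le [fM f0M [i fi] [j f0j]]]]] := EP w.
  exists (fun x => (f x - F x) ^+ 2 - (f0 x - F x) ^+ 2), (i, j); split => //.
  + by apply: measurable_funB; apply: measurable_funX; exact: measurable_funB.
  + by rewrite sumrB subr_le0.
  + by move=> x; apply: square_loss_diff_approx => //; exact: clamp_dist_le.
- rewrite lee_fin ler_pM2r ?invr_gt0// card_prod natrM.
  have e0 := expR_gt0 ((8 * C)^-1).
  (* ln 0 = 0, so the claim also covers an empty family. *)
  have [I0|I0] := posnP #|I|.
    by rewrite I0 mul0r ln0// addr0 mulr1 add0r lerD2l; nra.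
  rewrite lnM ?posrE ?ltr0n//.
  have lnI : 0 <= ln #|I|%:R :> R by rewrite ln_ge0// ler1n.
  have : 0 <= C * expR (8 * C)^-1 by rewrite mulr_ge0// ltW.
  have : 0 <= C * ln #|I|%:R * expR (8 * C)^-1 by rewrite !mulr_ge0// ltW.
  have : 0 <= C * ln #|I|%:R by rewrite mulr_ge0// ltW.
  nra.
Qed.

(** Any positive power absorbs the logarithm:
    t ln (n + 1) <= (n + 1)^t <= 2^t n^t. *)
Lemma ln_rate (R : realType) (C p t : R) : 0 <= C -> 0 <= p -> 0 < t ->
  exists2 C' : R, 0 < C' & forall n, (0 < n)%N ->
    C * (1 + p * ln n.+1%:R) / Num.sqrt n%:R <= C' * n%:R `^ (- 2^-1 + t).
Proof.
move=> C0 p0 t0.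
pose c := 2 `^ t / t.
have c0 : 0 <= c by rewrite divr_ge0 ?powR_ge0// ltW.
exists (1 + C * (1 + p * c)) => [|n n0].
  by rewrite ltr_wpDr// mulr_ge0// addr_ge0// mulr_ge0.
have n0R : 0 < n%:R :> R by rewrite ltr0n.
have n1R : 1 <= n%:R :> R by rewrite ler1n.
have nt1 : 1 <= n%:R `^ t by rewrite -[leLHS](powRr0 n%:R) ler_powR// ltW.
have ln_le : ln n.+1%:R <= c * n%:R `^ t.
  rewrite /c mulrAC ler_pdivlMr// mulrC -ln_powR -powRM//.
  apply: le_trans (ltW (ln_sublinear _)) _; first by rewrite powR_gt0.
  apply: (ge0_ler_powR (ltW t0)); rewrite ?nnegrE ?mulr_ge0//.
  by rewrite -natrM ler_nat mul2n -addnn -addn1 leq_add2l.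
rewrite powRD; last by rewrite [n%:R == 0]gt_eqF// implybT.
rewrite powRN powR12_sqrt// mulrCA mulrC ler_pM2l ?invr_gt0 ?sqrtr_gt0//.
have : p * ln n.+1%:R <= p * (c * n%:R `^ t) by exact: ler_wpM2l.
have : 0 <= n%:R `^ t :> R by exact: powR_ge0.
set a := n%:R `^ t in nt1 ln_le *; set b := ln _ => a0 pb.
have : C * (1 + p * b) <= C * (a + p * (c * a)).
  by apply: ler_wpM2l => //; lra.
nra.
Qed.

(** * The hypothesis class *)

Lemma le_norm_itv (R : realType) (a b t : R) :
  a <= t <= b -> `|t| <= `|a| + `|b|.
Proof.
move=> /andP[at_ tb].
have := ler_norm b; have := ler_norm (- a); rewrite normrN.
have := normr_ge0 a; have := normr_ge0 b.
by rewrite ler_norml; lra.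
Qed.

(** The extension by 0 outside the box is the product with the indicators of
    the coordinates, which avoids the measurability of the box itself. *)
Lemma measurable_hypothesis_input (R : realType) (a b : R) (d D : nat)
    (hidden : seq nat) (r : R) (f : d.-tuple R -> R) :
  hypothesis_class a b d hidden r f ->
  measurable_fun setT (fun u : (d + D).-tuple R => f (input a b u)).
Proof.
move=> [theta _ ->].
pose ind (x : d.-tuple R) : R := \prod_(i < d) \1_(`[a, b]) (tnth x i).
have -> : (fun x => realization theta (\col_i tnth x i)) \_ (closed_box a b d)
    = (fun x => realization theta (\col_i tnth x i) * ind x).
  apply/funext => x; rewrite patchE /ind.
  case: ifPn => [/set_mem xab|/negP xab].
    rewrite big1 ?mulr1// => i _; rewrite indicE mem_set//=.
    by rewrite in_itv /=; exact: xab.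
  have [i xi] : exists i, ~ (a <= tnth x i <= b).
    by apply/existsNP => H; apply: xab; apply/mem_set.
  by rewrite (bigD1 i)//= indicE memNset ?mul0r ?mulr0//= in_itv.
have min i : measurable_fun setT (fun u : (d + D).-tuple R => tnth (input a b u) i).
  under eq_fun do rewrite tnth_mktuple.
  apply: measurable_funD => //; apply: measurable_funM => //.
  exact: measurable_tnth.
apply: measurable_funM.
  apply: measurable_realization => i.
  by under eq_fun do rewrite mxE; exact: min.
apply: measurable_prod => i _.
apply: (measurableT_comp _ (min i)).
by apply: measurable_indic; exact: measurable_itv.
Qed.

Lemma hypothesis_class_bounded (R : realType) (a b : R) (d : nat)
    (hidden : seq nat) (r : R) :
  exists2 M : R, 0 <= M & forall f, hypothesis_class a b d hidden r f ->
    forall x, `|f x| <= M.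
Proof.
have [M MP] := realization_bounded d hidden r (`|a| + `|b|).
exists `|M| => // _ [theta thr ->] x; rewrite patchE.
case: ifPn => [/set_mem xab|_]; last by rewrite normr0.
apply: le_trans (ler_norm _); apply: MP => //.
apply/mx_norm_leP => [|i j]; first by rewrite addr_ge0.
by rewrite mxE; exact: le_norm_itv.
Qed.

Lemma hypothesis_class_net (R : realType) (a b : R) (d : nat)
    (hidden : seq nat) (r : R) : 0 < r ->
  exists2 K : R, 0 <= K & forall k : nat, (0 < k)%N ->
  exists (I : finType) (h : I -> d.-tuple R -> R),
    [/\ (#|I| = k.+1 ^ net_exponent d hidden)%N,
     forall i, hypothesis_class a b d hidden r (h i) &
     forall f, hypothesis_class a b d hidden r f ->
       exists i, forall x, `|f x - h i x| <= K / k%:R].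
Proof.
move=> r0.
have c0 : 0 <= `|a| + `|b| by rewrite addr_ge0.
have [K K0 KP] := realization_net d hidden r0 c0.
exists K => // k k0; have [I [g [cardI gr gnet]]] := KP k k0.
exists I, (fun i =>
  (fun x => realization (g i) (\col_j tnth x j)) \_ (closed_box a b d)).
split => // [i|_ [theta thr ->]]; first by exists (g i).
have [i iP] := gnet theta thr; exists i => x; rewrite !patchE.
case: ifPn => [/set_mem xab|_]; last by rewrite subrr normr0 divr_ge0.
have xc : `|\col_j tnth x j| <= `|a| + `|b|.
  by apply/mx_norm_leP => // i' j; rewrite mxE; exact: le_norm_itv.
have := iP _ _ 0 (lexx _) xc xc; rewrite add0r; apply.
by rewrite subrr normr0.
Qed.

(** (f - F)^2 <= 2 (f^2 + F^2). *)
Lemma integrable_square_loss (R : realType) (d : measure_display)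
    (T : measurableType d) (nu : probability T R) (F f : T -> R) (M : R) :
  measurable_fun setT F -> nu.-integrable setT (EFin \o (fun x => F x ^+ 2)) ->
  measurable_fun setT f -> (forall x, `|f x| <= M) ->
  nu.-integrable setT (EFin \o (fun x => (f x - F x) ^+ 2)).
Proof.
move=> mF iF2 mf fM.
have if2 : nu.-integrable setT (EFin \o (fun x => f x ^+ 2)).
  apply: (@bounded_integrable _ _ _ _ _ (M ^+ 2)); first exact: measurable_funX.
  move=> x; have M0 : 0 <= M by apply: le_trans (fM x).
  by rewrite normrX lerXn2r ?nnegrE.
have i2 : nu.-integrable setT (EFin \o (fun x => 2 * (f x ^+ 2 + F x ^+ 2))).
  exact: (integrableZl measurableT 2 (integrableD measurableT if2 iF2)).
apply: (le_integrable measurableT _ _ i2).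
  by apply/measurable_EFinP; apply: measurable_funX; exact: measurable_funB.
move=> x _ /=; rewrite lee_fin !ger0_norm ?sqr_ge0//; last first.
  by rewrite mulr_ge0// addr_ge0// sqr_ge0.
by have := sqr_ge0 (f x + F x); nra.
Qed.

(** * The rate *)

(** The net of precision K / n is finer than the 1 / sqrt n that
    [expected_excess_risk_le] asks for, and its cardinal, polynomial in n, costs
    only a logarithm. *)
Lemma expected_excess_rate (R : realType) (a b : R) (d D : nat)
  (F : (d + D).-tuple R -> R) (hidden : seq nat) (r : R)
  (nu : probability ((d + D).-tuple R) R)
  (disp : measure_display) (Omega : measurableType disp)
  (P : probability Omega R)
  (U : {RV P >-> (d + D).-tuple R}) (u : nat -> {RV P >-> (d + D).-tuple R})
  (fH : d.-tuple R -> R) (fnH : nat -> Omega -> d.-tuple R -> R) (t : R) :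
  let L := risk a b F P U in
  let Ln := fun n w => empirical_risk a b F n (fun i => u i w) in
  let H := hypothesis_class a b d hidden r in
  0 < r -> F \in Lfun nu 2%:E -> has_law U nu -> is_argmin H L fH ->
  (forall n w, (0 < n)%N -> is_argmin H (Ln n w) (fnH n w)) ->
  (forall n, (0 < n)%N -> measurable_fun setT (fun w => L (fnH n w))) ->
  (forall i, has_law (u i) nu) -> mutually_independent u -> 0 < t ->
  exists2 C : R, 0 < C & forall n, (0 < n)%N ->
    (0 <= \int[P]_w (L (fnH n w) - L fH) <= (C * n%:R `^ (- 2^-1 + t))%:E)%E.
Proof.
move=> L Ln H r0 F2 lawU [HfH fHmin] fnHmin mL lawu indu t0.
have mF : measurable_fun setT F.
  by move: F2; rewrite inE => /andP[]; rewrite inE.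
have iF2 := Lfun2_integrable_sqr F2.
have [M M0 HM] := hypothesis_class_bounded a b d hidden r.
have [K K0 HK] := hypothesis_class_net a b d hidden r0.
pose loss (f : d.-tuple R -> R) (x : (d + D).-tuple R) := (f (input a b x) - F x) ^+ 2.
have iloss f : H f -> nu.-integrable setT (EFin \o loss f).
  move=> Hf; apply: (integrable_square_loss mF iF2 (M := M)).
    exact: measurable_hypothesis_input Hf.
  by move=> x; exact: HM.
have LE f : H f -> L f = (\int[nu]_x loss f x)%:E.
  move=> Hf; rewrite /L /risk unlock fineK; last exact: integrable_fin_num (iloss f Hf).
  apply: (ge0_integral_has_law lawU (f := EFin \o loss f)).
    exact: measurable_int (iloss f Hf).
  by move=> x; rewrite lee_fin sqr_ge0.
have [C1 [C10 C1P]] := expected_excess_risk_le indu lawu mF iF2 M0 K0.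
have [C C0 CP] := ln_rate (ltW C10) (ler0n R (net_exponent d hidden)) t0.
exists C => // n n0.
have HfnH w : H (fnH n w) by case: (fnHmin n w n0).
have E0 w : (0 <= L (fnH n w) - L fH)%E.
  by rewrite sube_ge0 ?fHmin// LE.
apply/andP; split; first by apply: integral_ge0 => w _; exact: E0.
have [I [h [cardI Hh hnet]]] := HK n n0.
have n1 : 1 <= n%:R :> R by rewrite ler1n.
have s1 : 1 <= Num.sqrt n%:R :> R by rewrite -[leLHS]sqrtr1 ler_sqrt // (lt_le_trans ltr01).
have sn : K / n%:R <= K / Num.sqrt n%:R.
  apply: ler_wpM2l => //; rewrite lef_pV2 ?posrE ?sqrtr_gt0 ?ltr0n//.
  by rewrite -[leRHS]sqr_sqrtr// expr2 ler_peMr.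
apply: (@le_trans _ _ (C1 * (1 + ln #|I|%:R) / Num.sqrt n%:R)%:E%E); last first.
  by rewrite cardI natrX lnXn ?ltr0n// lee_fin -[ln _ *+ _]mulr_natl; exact: CP.
apply: (C1P n I (fun i x => h i (input a b x))) => //.
- by move=> i; exact: measurable_hypothesis_input (Hh i).
- by move=> i x; exact: HM.
- apply: emeasurable_funB; first exact: mL.
  exact: measurable_cst.
- move=> w; exists (fun x => fnH n w (input a b x)), (fun x => fH (input a b x)).
  split.
  + exact: measurable_hypothesis_input (HfnH w).
  + exact: measurable_hypothesis_input HfH.
  + by rewrite !LE// -EFinB (RintegralB measurableT (iloss _ (HfnH w)) (iloss _ HfH)).
  + have [_ /(_ _ HfH)] := fnHmin n w n0.
    by rewrite /Ln /empirical_risk ler_pM2l// invr_gt0 ltr0n.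
  + split; [by move=> x; apply: (HM _ (HfnH w))|by move=> x; apply: (HM _ HfH)| |].
    * have [i iP] := hnet _ (HfnH w); exists i => x.
      by apply: le_trans sn; exact: iP.
    * have [i iP] := hnet _ HfH; exists i => x.
      by apply: le_trans sn; exact: iP.
Qed.

Unset Implicit Arguments.
Set Strict Implicit.
Set Printing Implicit Defensive.

Theorem theorem3p3 (R : realType) (a b : R) (d D : nat)
  (F : (d + D).-tuple R -> R) (hidden : seq nat) (r : R)
  (B : 'I_(d + D) -> R)
  (disp : measure_display) (Omega : measurableType disp)
  (P : probability Omega R)
  (U : {RV P >-> (d + D).-tuple R}) (u : nat -> {RV P >-> (d + D).-tuple R})
  (fH : d.-tuple R -> R) (fnH : nat -> Omega -> d.-tuple R -> R) :
  let L := risk a b F P U in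
  let Ln := fun n w => empirical_risk a b F n (fun i => u i w) in
  let H := hypothesis_class a b d hidden r in
  let excess n := (\int[P]_w (L (fnH n w) - L fH))%E in
  a < b -> (0 < d)%N -> (0 < D)%N ->
  (2 <= (size hidden).+1)%N -> all (leq 1) hidden -> 0 < r ->
  F \in Lfun (uniform_cube R (d + D)) 2%:E ->
  has_law U (uniform_cube R (d + D)) ->
  is_argmin H L fH ->
  (forall n w, (0 < n)%N -> is_argmin H (Ln n w) (fnH n w)) ->
  (forall n, (0 < n)%N -> measurable_fun setT (fun w => L (fnH n w))) ->
  (forall i, 0 < B i) -> boundary_growth F B ->
  (forall i, has_law (u i) (uniform_cube R (d + D))) ->
  mutually_independent u ->
  eventually_bigO excess
    (fun n => n%:R `^ (- 2^-1 + \sum_i B i) * (ln n%:R) `^ 2^-1)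
  /\
  (boundary_growth_arbitrarily_small F ->
   forall eps : R, 0 < eps ->
   eventually_bigO excess (fun n => n%:R `^ (- 2^-1 + eps))).

Proof.
move=> L Ln H excess _ d0 _ _ _ r0 F2 lawU fHmin fnHmin mL B0 _ lawu indu.
have rate t : 0 < t -> exists2 C : R, 0 < C & forall n, (0 < n)%N ->
    (0 <= excess n <= (C * n%:R `^ (- 2^-1 + t))%:E)%E.
  exact: (expected_excess_rate r0 F2 lawU fHmin fnHmin mL lawu indu).
have bigO e' : (exists2 C : R, 0 < C & \forall n \near \oo,
    (0 <= excess n <= (C * e' n)%:E)%E) -> eventually_bigO excess e'.
  move=> [C C0 near_le]; split.
    near=> n; have /andP[e0 eC] : (0 <= excess n <= (C * e' n)%:E)%E by near: n.
    by rewrite ge0_fin_numE// (le_lt_trans eC)// ltry.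
  apply/eqO_exP; exists C => //; near=> n.
  have /andP[e0 eC] : (0 <= excess n <= (C * e' n)%:E)%E by near: n.
  have efin : excess n \is a fin_num.
    by rewrite ge0_fin_numE// (le_lt_trans eC)// ltry.
  rewrite /= ger0_norm ?fine_ge0//.
  apply: (@le_trans _ _ (C * e' n)); first by rewrite -lee_fin fineK.
  by rewrite ler_pM2l// ler_norm.
split.
  apply: bigO.
  have sB0 : 0 < \sum_i B i.
    rewrite (bigD1 (lshift D (Ordinal d0)))//= ltr_wpDr// sumr_ge0// => i _.
    exact: ltW.
  have [C C0 CP] := rate _ sB0; exists C => //.
  near=> n.
  have n0 : (0 < n)%N by near: n; exists 1%N.
  (* For n >= e the factor (ln n)^(1/2) is at least 1 and may be dropped. *)
  have ln1 : 1 <= ln n%:R :> R.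
    have en : expR 1 <= n%:R :> R by near: n; exact: nbhs_infty_ger.
    by rewrite -[leLHS]expRK ler_ln ?posrE ?expR_gt0// (lt_le_trans (expR_gt0 1)).
  have /andP[-> /le_trans] := CP n n0; apply.
  rewrite lee_fin ler_pM2l// ler_peMr ?powR_ge0//.
  by rewrite -[leLHS](powRr0 (ln n%:R)) ler_powR.
move=> _ eps eps0; apply: bigO.
have [C C0 CP] := rate _ eps0; exists C => //.
by exists 1%N => // n; exact: CP.
Unshelve. all: by end_near.
Qed.
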